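(* Let $\hat{\boldsymbol{\phi}}=(\phi_i^{[L]})_{i\ge0,\,L\ge1}$ be elements of a partially ordered commutative ring $R$, with $\phi_i^{[L]}:=0$ for $i<0$, such that the lower-triangular matrix $\Phi=(\phi^{[j+1]}_{i-j})_{i,j\ge0}$ is TP$_r$. Then: (a) The lower-triangular matrix $(\hat L_{n,k}(\hat{\boldsymbol{\phi}}))_{n,k\ge0}$ is TP$_r$. (c) The sequence $(\hat L_{n+1,1}(\hat{\boldsymbol{\phi}}))_{n\ge0}$ is Hankel-TP$_r$.
   Context: A partially ordered commutative ring is a commutative ring $R$ ($1\ne0$) with a subset $\mathcal P$ of nonnegative elements such that $0,1\in\mathcal P$, $\mathcal P$ is closed under addition and multiplication, and $\mathcal P\cap(-\mathcal P)=\{0\}$. A matrix is TP$_r$ if all its minors of size $\le r$ are nonnegative ($r$ a positive integer or $\infty$); a sequence $(a_n)$ is Hankel-TP$_r$ if $(a_{i+j})_{i,j\ge0}$ is TP$_r$. Level of a vertex: for a forest $F$ of increasing trees on a totally ordered vertex set with $k$ trees and a vertex $j$, let $r_j$ be the number of trees containing at least one vertex $\le j$; the level of $j$ is the number of children of vertices $<j$ whose labels are $>j$, plus $k+1-r_j$. An ordered tree is a rooted tree with linearly ordered children at each vertex; an increasing ordered tree on a set of integers is one bijectively labeled by that set so that children have larger labels than parents. $\hat L_{n,k}(\hat{\boldsymbol{\phi}})$ is the polynomial (evaluated in $R$) equal to the sum over unordered forests of $k$ increasing ordered trees whose vertex sets partition $[n]$ of $\prod_v\phi^{[L(v)]}_{i(v)}$,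 where $i(v)$ is the number of children and $L(v)$ the level of $v$ ($\hat L_{0,0}=1$). *)

(* Defs.v *)
From mathcomp Require Import all_boot all_order all_algebra.

Set Implicit Arguments.
Unset Strict Implicit.
Unset Printing Implicit Defensive.

Import GRing.Theory.
Local Open Scope ring_scope.

(* [P] is the set of nonnegative elements of a partial order on [R]. The
   nontriviality 1 != 0 is part of the structure [comNzRingType]. *)
Record nonneg_cone (R : comNzRingType) (P : R -> Prop) : Prop := NonnegCone {
  nonneg0 : P 0;
  nonneg1 : P 1;
  nonnegD : forall x y, P x -> P y -> P (x + y);
  nonnegM : forall x y, P x -> P y -> P (x * y);
  nonneg_anti : forall x, P x -> P (- x) -> x = 0 }.

(* The order of total positivity is [Some s] for an integer s and [None] for
   infinity. *)
Definition size_le (m : nat) (r : option nat) : bool :=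
  if r is Some s then (m <= s)%N else true.

Definition increasing_indices (m : nat) (f : 'I_m -> nat) : Prop :=
  forall i j : 'I_m, (i < j)%N -> (f i < f j)%N.

Definition minor (R : comNzRingType) (A : nat -> nat -> R) (m : nat)
    (f g : 'I_m -> nat) : R :=
  \det (\matrix_(i < m, j < m) A (f i) (g j)).

Definition TP (R : comNzRingType) (P : R -> Prop) (r : option nat)
    (A : nat -> nat -> R) : Prop :=
  forall (m : nat) (f g : 'I_m -> nat),
    size_le m r -> increasing_indices f -> increasing_indices g ->
    P (minor A f g).

Definition Hankel_TP (R : comNzRingType) (P : R -> Prop) (r : option nat)
    (a : nat -> R) : Prop :=
  TP P r (fun i j => a (i + j)%N).

Section Forests.
Variable n : nat.

(* A forest of ordered trees on n vertices is given by the ordered list of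
   children of each vertex. The vertex set {1, ..., n} is represented by
   'I_n = {0, ..., n-1}; only the relative order of labels matters. The bound n
   on the length of the lists only serves to get a finite type, as the lists of
   interest are duplicate-free. *)
Definition children_map := {ffun 'I_n -> {bseq n of 'I_n}}.

Implicit Types (F : children_map) (j v w : 'I_n).

(* Since children have larger labels than their parents there are no cycles,
   and every vertex has at most one parent, so [F] is a disjoint union of rooted
   trees covering all the vertices. No order is put on the trees themselves. *)
Definition is_increasing_ordered_forest F : bool :=
  [&& [forall v, uniq (F v)],
      [forall v, forall v', forall w,
         (w \in F v) && (w \in F v') ==> (v == v')]
    & [forall v, forall w, (w \in F v) ==> (v < w)%N]].

Definition child_rel F : rel 'I_n := fun v w => w \in F v.

Definition forest_roots F : {set 'I_n} :=
  [set w | [forall v, w \notin F v]].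

Definition num_trees F : nat := #|forest_roots F|.

Definition tree_vertices F (t : 'I_n) : {set 'I_n} :=
  [set v | connect (child_rel F) t v].

(* The number r_j of trees containing at least one vertex <= j; trees are
   indexed by their roots. *)
Definition num_trees_upto F j : nat :=
  #|[set t in forest_roots F | [exists v in tree_vertices F t, (v <= j)%N]]|.

(* The truncated subtraction is harmless: r_j never exceeds the number of
   trees, so that levels are at least 1. *)
Definition level F j : nat :=
  (#|[set w : 'I_n | (j < w)%N && [exists v : 'I_n, (v < j)%N && (w \in F v)]]|
   + (num_trees F + 1 - num_trees_upto F j))%N.

End Forests.

(* [phi i L] stands for phi_i^[L]; its values at L = 0 are never used. *)
Definition Lah (R : comNzRingType) (phi : nat -> nat -> R) (n k : nat) : R :=
  \sum_(F : children_map n | is_increasing_ordered_forest F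
                             && (num_trees F == k))
    \prod_(v < n) phi (size (F v)) (level F v).

(* The convention phi_i^[L] = 0 for i < 0 makes [Phi_matrix] lower-triangular. *)
Definition Phi_matrix (R : comNzRingType) (phi : nat -> nat -> R)
    (i j : nat) : R :=
  if (j <= i)%N then phi (i - j)%N j.+1 else 0.

(* Main.v *)
(* Write [L] for the matrix [Lah phi] and [B] for [Phi] conjugated by the diagonal
   matrix of factorials, [B j k = j! / k! * Phi j k]. Removing the minimal vertex
   from a forest with k+1 trees leaves a forest with j = k+i trees, in which the
   i former children form an ordered choice of roots, made in j!/k! ways; the
   levels of the other vertices do not change, since the level of [v] counts
   (plus one) the vertices [w > v] whose parent, if any, is smaller than [v].
   Hence [L] is the direct sum of 1 and [L B], and Cauchy-Binet gives (a) by
   induction on the number of rows. Iterating the recurrence, the Hankel matrix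
   of (c) is [L M] with [M = B [e_0 | Delta M]], where [Delta] deletes the first
   row, so [M] is totally positive by induction on the number of columns. *)

Require Import Defs.
From mathcomp Require Import all_boot all_order all_algebra all_fingroup.
From mathcomp Require Import zify.

Set Implicit Arguments.
Unset Strict Implicit.
Unset Printing Implicit Defensive.

Import GRing.Theory.
Local Open Scope ring_scope.

(** * Cauchy-Binet formula *)

Section CauchyBinet.
Variables (R : comNzRingType) (m N : nat).
Implicit Types (A : 'M[R]_(m, N)) (C : 'M[R]_(N, m)) (t h : m.-tuple 'I_N).

Local Notation ltI := (relpre (@nat_of_ord N) ltn).
Local Notation leI := (relpre (@nat_of_ord N) leq).

(** Multilinearity in the rows: row [i] of the product is a combination of the rows of [C], and [t]
    records which row is chosen for each [i]. *)
Lemma det_mulmx_tuples A C :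
  \det (A *m C) =
    \sum_t (\prod_i A i (tnth t i)) * \det (rowsub (tnth t) C).
Proof.
pose toff t : {ffun 'I_m -> 'I_N} := [ffun i => tnth t i].
have toff_bij : bijective toff.
  exists (fun f : {ffun 'I_m -> 'I_N} => [tuple f i | i < m]) => [t | f].
    by apply: eq_from_tnth => i; rewrite tnth_mktuple ffunE.
  by apply/ffunP => i; rewrite ffunE tnth_mktuple.
transitivity (\sum_(s : 'S_m) \sum_(f : {ffun 'I_m -> 'I_N})
    (-1) ^+ s * \prod_i (A i (f i) * C (f i) (s i))).
  apply: eq_bigr => s _; rewrite -big_distrr /=; congr (_ * _).
  rewrite -(bigA_distr_bigA (fun i k => A i k * C k (s i))) /=.
  by apply: eq_bigr => i _; rewrite mxE.
rewrite exchange_big (reindex toff) /=; last exact: onW_bij.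
apply: eq_bigr => t _; rewrite big_distrr /=; apply: eq_bigr => s _.
rewrite big_split /= mulrCA; congr (_ * (_ * _)).
  by apply: eq_bigr => i _; rewrite ffunE.
by apply: eq_bigr => i _; rewrite mxE ffunE.
Qed.

Lemma det_rowsub_non_uniq C t : ~~ uniq t -> \det (rowsub (tnth t) C) = 0.
Proof.
move=> /(tuple_uniqP _) not_inj.
have /injectivePn[i [j neq_ij eq_t]] : ~~ injectiveb (tnth t).
  by apply/injectiveP.
by apply: (determinant_alternate neq_ij) => k; rewrite !mxE eq_t.
Qed.

Lemma sorted_ltI t : uniq t -> sorted ltI (sort leI t).
Proof.
move=> t_uniq; have -> : sorted ltI (sort leI t) = sorted ltn (map val (sort leI t)).
  by rewrite sorted_map.
rewrite ltn_sorted_uniq_leq (map_inj_uniq val_inj) sort_uniq t_uniq sorted_map.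
by apply: sort_sorted => i j; apply: leq_total.
Qed.

Lemma sort_tupleP t : size (sort leI t) == m.
Proof. by rewrite size_sort size_tuple. Qed.

(** The duplicate-free tuples that sort to [h] are the rearrangements of [h], and distinct
    permutations give distinct ones because [h] is injective. *)
Lemma sorted_permutations h (F : m.-tuple 'I_N -> R) : sorted ltI h ->
  \sum_(t : m.-tuple 'I_N | uniq t && (Tuple (sort_tupleP t) == h)) F t =
  \sum_(s : 'S_m) F [tuple tnth h (s i) | i < m].
Proof.
move=> h_lt.
have leI_tr : transitive leI by move=> x y z; apply: leq_trans.
have leI_anti : antisymmetric leI.
  by move=> i j le_ij; apply/val_inj/anti_leq.
have leI_total : total leI by move=> i j; apply: leq_total.
have h_uniq : uniq h.
  apply: (sorted_uniq _ _ h_lt) => [x y z|x]; [exact: ltn_trans|exact: ltnn].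
have h_le : sorted leI h.
  by apply: sub_sorted h_lt => x y; apply: ltnW.
pose c (s : 'S_m) := [tuple tnth h (s i) | i < m].
have c_inj : injective c.
  move=> s s' eq_c; apply/permP => i; have h_inj := elimT (tuple_uniqP _) h_uniq.
  by apply: h_inj; move/(congr1 (fun t => tnth t i)): eq_c; rewrite !tnth_mktuple.
rewrite -[RHS](big_imset (h := c) (A := predT) _ (in2W c_inj)).
apply: eq_bigl => t; apply/andP/imsetP => [[t_uniq /eqP sort_t] | [s _ ->]].
  have /tuple_permP[s def_t] : perm_eq t h.
    by rewrite -sort_t /= perm_sym perm_sort.
  by exists s => //; apply: val_inj.
have perm_ch : perm_eq (c s) h by apply/tuple_permP; exists s.
split; first by rewrite (perm_uniq perm_ch).
apply/eqP/val_inj; rewrite /= -[RHS](sorted_sort leI_tr h_le).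
exact/perm_sortP.
Qed.

(** Tuples with a repeated index contribute 0, and the others are grouped by their sorted form [h].
    Rearranging the rows of [C] only costs a sign, which completes the Leibniz expansion of the
    minor of [A]. *)
Theorem cauchy_binet A C :
  \det (A *m C) = \sum_(h : m.-tuple 'I_N | sorted ltI h)
    \det (colsub (tnth h) A) * \det (rowsub (tnth h) C).
Proof.
rewrite det_mulmx_tuples (bigID (fun t : m.-tuple 'I_N => uniq t)) /= addrC.
rewrite big1 ?add0r => [|t]; last first.
  by move/det_rowsub_non_uniq=> ->; rewrite mulr0.
rewrite (partition_big (fun t : m.-tuple 'I_N => Tuple (sort_tupleP t))
  (fun h : m.-tuple 'I_N => sorted ltI h)) /=;
  last by move=> t; apply: sorted_ltI.
apply: eq_bigr => h h_lt; rewrite sorted_permutations // big_distrl /=.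
apply: eq_bigr => s _; rewrite -mulrA mulrCA; congr (_ * _).
  by apply: eq_bigr => i _; rewrite tnth_mktuple mxE.
rewrite -det_perm -det_mulmx -row_permE; congr (\det _).
by apply/matrixP => i j; rewrite !mxE tnth_mktuple.
Qed.

End CauchyBinet.

(** * Operations preserving total positivity *)

Section TotalPositivity.
Variables (R : comNzRingType) (P : R -> Prop) (r : option nat).
Hypothesis hP : nonneg_cone P.
Implicit Types A C : nat -> nat -> R.

Definition lower_triangular A := forall i j, (i < j)%N -> A i j = 0.

(* The matrix product [A C] when [A] is lower-triangular. *)
Definition lmul A C i j : R := \sum_(k < i.+1) A i k * C k j.

Definition add_row0 A i j : R := if i is i'.+1 then A i' j else 0.

(** Applied to [add_row0 A], this gives the direct sum of 1 and [A]. *)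
Definition add_unit_col A i j : R := if j is j'.+1 then A i j' else (i == 0%N)%:R.

Lemma nonneg_sum (I : finType) (Q : pred I) (F : I -> R) :
  (forall i, Q i -> P (F i)) -> P (\sum_(i | Q i) F i).
Proof. by move=> hF; apply: big_ind => //; [apply: nonneg0|apply: nonnegD]. Qed.

Lemma nonneg_mulrn x n : P x -> P (x *+ n).
Proof.
move=> hx; elim: n => [|n IHn]; first by rewrite mulr0n; apply: nonneg0.
by rewrite mulrS; apply: nonnegD.
Qed.

Lemma size_leS m : size_le m.+1 r -> size_le m r.
Proof. by case: r => //= s /ltnW. Qed.

Lemma increasing_gt0 m (f : 'I_m.+1 -> nat) :
  increasing_indices f -> (0 < f ord0)%N -> forall i, (0 < f i)%N.
Proof.
move=> f_inc f_gt0 i; case: (posnP i) => [i0|i_gt0].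
  by have -> : i = ord0 by apply: val_inj.
exact: leq_trans (f_inc ord0 i i_gt0).
Qed.

Lemma increasing_pred m (f : 'I_m -> nat) :
  increasing_indices f -> (forall i, 0 < f i)%N ->
  increasing_indices (fun i => (f i).-1).
Proof. by move=> f_inc f_gt0 i j /f_inc; move: (f_gt0 i) (f_gt0 j); lia. Qed.

Lemma increasing_lift0 m (f : 'I_m.+1 -> nat) :
  increasing_indices f -> increasing_indices (fun i => f (lift ord0 i)).
Proof. by move=> f_inc i j lt_ij; apply: f_inc. Qed.

Lemma increasing_lift0_gt0 m (f : 'I_m.+1 -> nat) :
  increasing_indices f -> (forall i, 0 < f (lift ord0 i))%N.
Proof. by move=> f_inc i; apply: leq_ltn_trans (f_inc ord0 (lift ord0 i) _). Qed.

Lemma eq_minor A C m (f g : 'I_m -> nat) :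
  (forall i j, A (f i) (g j) = C (f i) (g j)) -> minor A f g = minor C f g.
Proof.
by move=> eqAC; congr (\det _); apply/matrixP => i j; rewrite !mxE.
Qed.

Lemma eq_TP A C : A =2 C -> TP P r A -> TP P r C.
Proof.
by move=> eqAC hA m f g *; rewrite -(eq_minor (A := A)) //; apply: hA.
Qed.

(** A minor involves only finitely many entries; this reduces total positivity to truncated
    matrices, on which one can argue by induction. *)
Lemma TP_limit A :
  (forall N, exists2 C, TP P r C &
     forall i j, (i < N)%N -> (j < N)%N -> A i j = C i j) -> TP P r A.
Proof.
move=> hA m f g m_le f_inc g_inc.
have [C hC eqAC] := hA (\max_i f i + \max_i g i).+1.
rewrite (eq_minor (C := C)) => [|i j]; first exact: hC.
have := leq_bigmax (F := f) i; have := leq_bigmax (F := g) j => ? ?.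
by apply: eqAC; rewrite ltnS; lia.
Qed.

Lemma TP_zero : TP P r (fun _ _ => 0).
Proof.
move=> [|m] f g _ _ _; first by rewrite /minor det_mx00; apply: nonneg1.
rewrite /minor (expand_det_row _ ord0) big1 => [|j _]; last by rewrite mxE mul0r.
exact: nonneg0.
Qed.

Lemma TP_add_row0 A : TP P r A -> TP P r (add_row0 A).
Proof.
move=> hA [|m] f g m_le f_inc g_inc; first by rewrite /minor det_mx00; apply: nonneg1.
case: (posnP (f ord0)) => [f0|f0_gt0].
  rewrite /minor (expand_det_row _ ord0) big1 => [|j _]; last by rewrite mxE f0 mul0r.
  exact: nonneg0.
have f_gt0 := increasing_gt0 f_inc f0_gt0.
have -> : minor (add_row0 A) f g = minor A (fun i => (f i).-1) g.
  congr (\det _); apply/matrixP => i j; rewrite !mxE.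
  by move: (f_gt0 i); case: (f i).
by apply: hA => //; apply: increasing_pred.
Qed.

(** A minor using the new column is expanded along it: only its top entry can be nonzero, as all
    later row indices are positive. What remains is 0 or a smaller minor of [A]. *)
Lemma TP_add_unit_col A : TP P r A -> TP P r (add_unit_col A).
Proof.
move=> hA [|m] f g m_le f_inc g_inc; first by rewrite /minor det_mx00; apply: nonneg1.
case: (posnP (g ord0)) => [g0|g0_gt0]; last first.
  have g_gt0 := increasing_gt0 g_inc g0_gt0.
  have -> : minor (add_unit_col A) f g = minor A f (fun i => (g i).-1).
    congr (\det _); apply/matrixP => i j; rewrite !mxE.
    by move: (g_gt0 j); case: (g j).
  by apply: hA => //; apply: increasing_pred.
rewrite /minor (expand_det_col _ ord0) big_ord_recl big1 => [|i _]; last first.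
  rewrite mxE g0 /= -[_ == 0%N]negbK -lt0n.
  by rewrite increasing_lift0_gt0 ?mul0r.
rewrite addr0 mxE g0 /=; case: eqP => [f0|_]; last by rewrite mul0r; apply: nonneg0.
rewrite mul1r /cofactor expr0 mul1r.
have -> : row' ord0 (col' ord0 (\matrix_(i, j) add_unit_col A (f i) (g j)))
    = \matrix_(i < m, j < m) A (f (lift ord0 i)) (g (lift ord0 j)).-1.
  apply/matrixP => i j; rewrite !mxE.
  by move: (increasing_lift0_gt0 g_inc j); case: (g _).
apply: (hA m (fun i => f (lift ord0 i)) (fun i => (g (lift ord0 i)).-1)).
- exact: size_leS.
- exact: increasing_lift0.
- by apply: increasing_pred; [exact: increasing_lift0|exact: increasing_lift0_gt0].
Qed.

Lemma TP_lmul A C :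
  lower_triangular A -> TP P r A -> TP P r C -> TP P r (lmul A C).
Proof.
move=> A_low hA hC m f g m_le f_inc g_inc.
(* [N] exceeds every row index used, so by triangularity the sums of varying length in [lmul] all
   extend to a common range. *)
pose N := (\max_i f i).+1.
have -> : minor (lmul A C) f g =
    \det ((\matrix_(i < m, k < N) A (f i) k) *m (\matrix_(k < N, j < m) C k (g j))).
  congr (\det _); apply/matrixP => i j; rewrite !mxE /lmul.
  rewrite (big_ord_widen N (fun k => A (f i) k * C k (g j))); last first.
    by rewrite ltnS; apply: (leq_bigmax (F := f)).
  rewrite big_mkcond; apply: eq_bigr => k _; rewrite !mxE.
  by case: ltnP => // /A_low ->; rewrite mul0r.
rewrite cauchy_binet; apply: nonneg_sum => h h_lt.
have h_inc : increasing_indices (fun i => tnth h i : nat).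
  move=> i j lt_ij; rewrite !(tnth_nth (ord0 : 'I_N)).
  have tr : transitive (relpre (@nat_of_ord N) ltn) by move=> x y z; apply: ltn_trans.
  by apply: (sorted_ltn_nth tr _ h_lt) => //; rewrite inE size_tuple.
apply: nonnegM => //.
- rewrite (_ : colsub _ _ = \matrix_(i, j) A (f i) (tnth h j)); first exact: hA.
  by apply/matrixP => i j; rewrite !mxE.
- rewrite (_ : rowsub _ _ = \matrix_(i, j) C (tnth h i) (g j)).
    exact: (hC m (fun i => tnth h i : nat) g).
  by apply/matrixP => i j; rewrite !mxE.
Qed.

(** Each factor is the quotient of factorials [(f i)! / (g (s i))!], so the product of falling
    factorials does not depend on [s]. *)
Lemma prod_ffact_perm m (f g : 'I_m -> nat) (s : 'S_m) :
  (forall i, g (s i) <= f i)%N ->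
  (\prod_i f i ^_ (f i - g (s i)) * \prod_i (g i)`! = \prod_i (f i)`!)%N.
Proof.
move=> le_gf; rewrite [X in (_ * X)%N](reindex_perm s) -big_split /=.
apply: eq_bigr => i _; rewrite -[RHS](ffact_fact (leq_subr (g (s i)) _)).
by rewrite subKn.
Qed.

(* Since [j ^_ (j - k) = j! / k!], this is conjugation by the diagonal matrix of
   factorials, which is not invertible over [R]. *)
Lemma TP_ffact A : lower_triangular A -> TP P r A ->
  TP P r (fun j k => A j k *+ (j ^_ (j - k))).
Proof.
move=> A_low hA m f g m_le f_inc g_inc.
have prodA (s : 'S_m) : ~~ [forall i, g (s i) <= f i]%N ->
    \prod_i A (f i) (g (s i)) = 0.
  by move=> /forallPn[i]; rewrite -ltnNge => /A_low A0; rewrite (bigD1 i) //= A0 mul0r.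
pose good (s : 'S_m) := [forall i, g (s i) <= f i]%N.
(* Leibniz terms of permutations that are not [good] vanish, and all the others acquire the same
   integer factor [c], computed from any good [s0]. *)
case: (pickP good) => [s0 s0_good | bad].
  pose c := (\prod_i f i ^_ (f i - g (s0 i)))%N.
  have -> : minor (fun j k => A j k *+ (j ^_ (j - k))) f g = minor A f g *+ c.
    rewrite /minor /determinant -sumrMnl; apply: eq_bigr => s _.
    rewrite -mulrnAr; congr (_ * _).
    transitivity ((\prod_i A (f i) (g (s i))) *+ \prod_i f i ^_ (f i - g (s i))).
      by rewrite -prodrMn; apply: eq_bigr => i _; rewrite mxE.
    rewrite [in RHS](eq_bigr (fun i => A (f i) (g (s i)))) => [|i _]; last by rewrite mxE.
    case: (boolP (good s)) => [s_good | /prodA ->]; last by rewrite !mul0rn.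
    congr (_ *+ _); apply/eqP.
    (* The division by factorials takes place in the natural numbers, where cancellation is
       available. *)
    have g_gt0 : (0 < \prod_i (g i)`!)%N by rewrite prodn_gt0 // => i; rewrite fact_gt0.
    rewrite -(eqn_pmul2r g_gt0) !prod_ffact_perm //; exact/forallP.
  exact/nonneg_mulrn/hA.
rewrite /minor /determinant big1 => [|s _]; first exact: nonneg0.
have /forallPn[i] : ~~ good s by rewrite bad.
rewrite -ltnNge => /A_low A0; rewrite (bigD1 i) //= mxE A0 mul0rn mul0r.
exact: mulr0.
Qed.

(** * Total positivity from a production matrix *)

Section Production.
Variables B L : nat -> nat -> R.
Hypotheses (B_TP : TP P r B) (B_low : lower_triangular B).
Hypotheses (L0 : forall k, L 0%N k = (k == 0%N)%:R) (LS0 : forall n, L n.+1 0%N = 0).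
Hypothesis LSS : forall n k, L n.+1 k.+1 = lmul L B n k.

Lemma production_lower : lower_triangular L.
Proof.
elim=> [|n IHn] [|k] //= lt_nk.
rewrite LSS /lmul big1 // => j _.
by rewrite B_low ?mulr0 //; apply: leq_trans (ltn_ord j) lt_nk.
Qed.

Lemma TP_production : TP P r L.
Proof.
(* Row [n.+1] of [L] depends only on row [n], so the first [N.+1] rows are determined by the first
   [N]. *)
pose trunc N i j : R := if (i < N)%N then L i j else 0.
have trunc_TP N : TP P r (trunc N).
  elim: N => [|N IHN]; first exact: TP_zero.
  have trunc_low : lower_triangular (trunc N).
    by move=> i j lt_ij; rewrite /trunc production_lower ?if_same.
  (* [L] is the direct sum of 1 and [L B], and this respects the truncation. *)
  apply: (eq_TP _ (TP_add_unit_col (TP_add_row0 (TP_lmul trunc_low IHN B_TP)))).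
  move=> [|i] [|j] //=; rewrite /trunc ?ltnS ?L0 ?LS0 ?if_same //.
  rewrite LSS /lmul; case: ltnP => // _; rewrite big1 // => k _; exact: mul0r.
by apply: TP_limit => N; exists (trunc N) => // i j lt_iN _; rewrite /trunc lt_iN.
Qed.

(** Column [j] of the matrix [M], that is [B (Delta B)^j e_0]. The column index comes first because
    the recursion is on it. *)
Fixpoint first_moment_col j i : R :=
  if j is j'.+1 then \sum_(k < i.+1) B i k * first_moment_col j' k.+1 else B i 0%N.

Lemma TP_first_moment_col : TP P r (fun i j => first_moment_col j i).
Proof.
pose trunc N i j : R := if (j < N)%N then first_moment_col j i else 0.
have trunc_TP N : TP P r (trunc N).
  elim: N => [|N IHN]; first exact: TP_zero.
  have shift_TP : TP P r (fun i j => trunc N i.+1 j).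
    move=> m f g m_le f_inc g_inc.
    apply: (IHN m (fun i => (f i).+1) g) => // i j lt_ij; exact: f_inc.
  (* This is [M = B [e_0 | Delta M]], which expresses the first [N.+1] columns of [M] through the
     first [N]. *)
  apply: (eq_TP _ (TP_lmul B_low B_TP (TP_add_unit_col shift_TP))).
  move=> i [|j]; rewrite /lmul /trunc /= ?ltnS.
    by rewrite big_ord_recl mulr1 big1 ?addr0 // => k _; rewrite mulr0.
  by case: ltnP => // _; rewrite big1 // => k _; rewrite mulr0.
by apply: TP_limit => N; exists (trunc N) => // i j _ lt_jN; rewrite /trunc lt_jN.
Qed.

(** One unit is moved from [j] to [i]: row [i.+1] of [L] is 0 followed by row [i] of [L B], and [B]
    times the shifted column [j] of [M] is column [j.+1]. *)
Lemma production_first_moment i j :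
  L (i + j).+1 1%N = lmul L (fun k l => first_moment_col l k) i j.
Proof.
elim: j i => [|j IHj] i; first by rewrite addn0 LSS.
rewrite addnS -addSn IHj /lmul big_ord_recl LS0 mul0r add0r.
under eq_bigr => k _ do rewrite lift0 LSS /lmul big_distrl /=.
rewrite exchange_big /=; apply: eq_bigr => l _; rewrite big_distrr /=.
(* The two inner sums have different ranges; the extra terms lie above the diagonal of [B]. *)
rewrite (big_ord_widen i.+1 (fun k => L i l * (B l k * first_moment_col j k.+1))) //.
rewrite [RHS]big_mkcond; apply: eq_bigr => k _; rewrite mulrA.
by case: ltnP => // /B_low ->; rewrite mulr0 mul0r.
Qed.

Lemma Hankel_TP_production : Hankel_TP P r (fun n => L n.+1 1%N).
Proof.
apply: (eq_TP (fun i j => esym (production_first_moment i j))).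
exact: TP_lmul production_lower TP_production TP_first_moment_col.
Qed.

End Production.

End TotalPositivity.

(** * Levels in increasing ordered forests *)

Section ForestLevels.
Variable n : nat.
Implicit Types (F : children_map n) (j v w : 'I_n).

Lemma increasing_ordered_forestP F :
  reflect [/\ forall v, uniq (F v),
              forall v v' w, w \in F v -> w \in F v' -> v = v'
            & forall v w, w \in F v -> (v < w)%N]
          (is_increasing_ordered_forest F).
Proof.
apply: (iffP and3P) => [[/forallP uF /forallP pF /forallP iF] | [uF pF iF]].
  split=> // [v v' w wv wv'|v w wv].
    by have /forallP/(_ v')/forallP/(_ w) := pF v; rewrite wv wv' => /eqP.
  by have /forallP/(_ w)/implyP := iF v; apply.
split; first exact/forallP.
  apply/forallP => v; apply/forallP => v'; apply/forallP => w; apply/implyP.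
  by move=> /andP[wv wv']; apply/eqP/(pF _ _ w).
by apply/forallP => v; apply/forallP => w; apply/implyP/iF.
Qed.

(** Labels increase along paths, so the root is the smallest vertex of its tree. *)
Lemma num_trees_uptoE F j : is_increasing_ordered_forest F ->
  num_trees_upto F j = #|[set t in forest_roots F | (t <= j)%N]|.
Proof.
case/increasing_ordered_forestP=> _ _ iF; apply: eq_card => t; rewrite !inE.
congr (_ && _); apply/existsP/idP => [[v]|le_tj]; last first.
  by exists t; rewrite inE connect0.
rewrite inE => /andP[/connectP[p t_p ->]]; apply: leq_trans.
elim: p t t_p => //= u p IHp t /andP[/iF lt_tu /IHp]; exact/leq_trans/ltnW.
Qed.

(** The trees with no vertex up to [j] are those with root above [j]. Their roots [D] are disjoint
    from the set [A] of children, and together they are the vertices above [j] with no parent or a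
    parent below [j]. *)
Lemma levelE F j : is_increasing_ordered_forest F ->
  level F j =
    #|[set w : 'I_n | (j < w)%N && [forall v, (w \in F v) ==> (v < j)%N]]|.+1.
Proof.
move=> hF; have [_ pF _] := increasing_ordered_forestP _ hF.
rewrite /level num_trees_uptoE // /num_trees.
rewrite -(cardsID [set t : 'I_n | (t <= j)%N] (forest_roots F)).
have -> : forest_roots F :&: [set t : 'I_n | (t <= j)%N] =
    [set t in forest_roots F | (t <= j)%N] by apply/setP => t; rewrite !inE.
rewrite -addnA addKn addn1 addnS; congr _.+1.
set A := [set w | _]; set D := _ :\: _.
have -> : [set w : 'I_n | (j < w)%N && [forall v, (w \in F v) ==> (v < j)%N]] =
    A :|: D.
  apply/setP => w; rewrite !inE -ltnNge andbC -andb_orr andbC.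
  congr (_ && _); apply/forallP/orP => [ltF|[/existsP[u /andP[lt_uj wu]] v|/forallP rF v]].
  - case: (boolP [forall v, w \notin F v]) => [|/forallPn[v]]; first by right.
    by rewrite negbK => wv; left; apply/existsP; exists v; rewrite wv (implyP (ltF v)).
  - by apply/implyP => wv; rewrite (pF v u w).
  - by rewrite (negbTE (rF v)).
rewrite cardsU (_ : A :&: D = set0) ?cards0 ?subn0 //.
apply/setP => w; rewrite !inE; apply/negP => /andP[/andP[_ /existsP[v /andP[_ wv]]]].
by case/andP=> _ /forallP/(_ v); rewrite wv.
Qed.

Lemma num_trees_le F : (num_trees F <= n)%N.
Proof. by rewrite -[n in (_ <= n)%N]card_ord max_card. Qed.

(** Widening embeds the [i]-tuples as the bounded sequences of length [i], and duplicate-free tuples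
    are counted by falling factorials. *)
Lemma card_uniq_bseqs (A : {set 'I_n}) i : (i <= n)%N ->
  #|[set s : n.-bseq 'I_n | [&& uniq s, all [in A] s & size s == i]]| =
  (#|A| ^_ i)%N.
Proof.
move=> le_in; rewrite -card_uniq_tuples.
pose f (t : i.-tuple 'I_n) : n.-bseq 'I_n := widen_bseq le_in (bseq_of_tuple t).
have f_inj : injective f by move=> t t' /(congr1 val) /= /val_inj.
rewrite -(card_imset _ f_inj); apply: eq_card => s; rewrite inE.
apply/and3P/imsetP => [[us As si]|[t + ->]]; last first.
  by rewrite inE => /andP[At ut]; split=> //=; rewrite size_tuple.
by exists (Tuple si); [rewrite inE us andbT|apply: val_inj].
Qed.

End ForestLevels.

(** * Adding a minimal vertex to a forest *)

Section AddVertex.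
Variable n : nat.
Implicit Types (F : children_map n) (s : n.-bseq 'I_n) (G : children_map n.+1).

(* Shift all labels by one and graft the trees rooted at [s], in this order,
   below a new minimal vertex. *)
Definition graft F s : children_map n.+1 :=
  [ffun v => widen_bseq (leqnSn n)
     [bseq of map (lift (@ord0 n)) (oapp (fun w : 'I_n => F w) s (unlift ord0 v))]].

(** Here [pmap (unlift ord0)] lowers the labels and drops [ord0], while [insub_bseq] would turn an
    overlong list into the empty one. Neither loss occurs when [G] is an increasing forest. *)
Definition ungraft G : children_map n * n.-bseq 'I_n :=
  ([ffun w => insub_bseq n (pmap (unlift ord0) (G (lift ord0 w)))],
   insub_bseq n (pmap (unlift ord0) (G ord0))).

Lemma graft0 F s : graft F s ord0 = map (lift ord0) s :> seq _.
Proof. by rewrite ffunE unlift_none. Qed.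

Lemma graft_lift F s v :
  graft F s (lift ord0 v) = map (lift ord0) (F v) :> seq _.
Proof. by rewrite ffunE liftK. Qed.

Lemma mem_graft0 F s w : (lift ord0 w \in graft F s ord0) = (w \in s).
Proof. by rewrite membsE graft0 mem_map //; apply: lift_inj. Qed.

Lemma mem_graft_lift F s v w :
  (lift ord0 w \in graft F s (lift ord0 v)) = (w \in F v).
Proof. by rewrite membsE graft_lift mem_map //; apply: lift_inj. Qed.

Lemma ord0_notin_graft F s v : ord0 \notin graft F s v.
Proof.
rewrite membsE ffunE; apply/mapP => -[w _ /eqP].
by rewrite (negbTE (neq_lift _ _)).
Qed.

Lemma graftK F s : ungraft (graft F s) = (F, s).
Proof.
congr (_, _); last by rewrite graft0 (map_pK (@liftK _ _)) /insub_bseq valKd.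
by apply/ffunP => w; rewrite ffunE graft_lift (map_pK (@liftK _ _)) /insub_bseq valKd.
Qed.

Lemma ungraftK G : is_increasing_ordered_forest G ->
  graft (ungraft G).1 (ungraft G).2 = G.
Proof.
case/increasing_ordered_forestP=> uG _ iG.
have unliftK : ocancel (unlift (@ord0 n)) (lift ord0).
  by move=> v; case: unliftP.
have Gv v : map (lift ord0) (insub_bseq n (pmap (unlift ord0) (G v))) = G v.
  (* The minimal vertex is nobody's child, so nothing is dropped. *)
  have eq_Gv : map (lift ord0) (pmap (unlift ord0) (G v)) = G v.
    rewrite (pmap_filter unliftK); apply/all_filterP/allP => w /iG.
    by case: unliftP => //= ->.
  rewrite /insub_bseq insubdK // unfold_in /=.
  have : uniq (pmap (unlift ord0) (G v)).
    by rewrite -(map_inj_uniq (@lift_inj _ ord0)) eq_Gv.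
  by move/card_uniqP <-; rewrite -[n in (_ <= n)%N]card_ord max_card.
apply/ffunP => v; apply: val_inj; rewrite ffunE /= -[RHS]Gv.
by case: (unliftP ord0 v) => [w|] ->; rewrite /= ?ffunE.
Qed.

(** A minimal new vertex keeps labels increasing; uniqueness of parents in the graft forces the
    vertices in [s] to be roots of [F]. *)
Lemma graft_forest F s :
  is_increasing_ordered_forest (graft F s) =
  [&& is_increasing_ordered_forest F, uniq s & all [in forest_roots F] s].
Proof.
apply/increasing_ordered_forestP/and3P => [[uG pG iG] | [hF us rs]].
  split; last 2 first.
  - by move: (uG ord0); rewrite graft0 map_inj_uniq //; apply: lift_inj.
  - apply/allP => w ws; rewrite inE; apply/forallP => v; apply/negP => wv.
    have := pG ord0 (lift ord0 v) (lift ord0 w).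
    rewrite mem_graft0 mem_graft_lift => /(_ ws wv)/eqP.
    by rewrite (negbTE (neq_lift _ _)).
  apply/increasing_ordered_forestP; split=> [v|v v' w wv wv'|v w wv].
  - by move: (uG (lift ord0 v)); rewrite graft_lift map_inj_uniq //; apply: lift_inj.
  - apply: (@lift_inj _ ord0); apply: (pG _ _ (lift ord0 w));
    by rewrite mem_graft_lift.
  - by have := iG (lift ord0 v) (lift ord0 w); rewrite mem_graft_lift; apply.
have [uF pF iF] := increasing_ordered_forestP _ hF.
have sF v w : w \in s -> w \in F v -> False.
  by move=> /(allP rs); rewrite inE => /forallP/(_ v)/negP.
split=> [v|v v' w|v w].
- case: (unliftP ord0 v) => [u|] ->; rewrite ?graft_lift ?graft0 map_inj_uniq //;
  exact: lift_inj.
- case: (unliftP ord0 w) => [u|] ->; last by rewrite (negbTE (ord0_notin_graft _ _ _)).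
  case: (unliftP ord0 v) => [x|] ->; case: (unliftP ord0 v') => [x'|] -> //;
    rewrite ?mem_graft_lift ?mem_graft0 => uv uv'.
  + by rewrite (pF x x' u).
  + by case: (sF x u).
  + by case: (sF x' u).
- case: (unliftP ord0 w) => [u|] ->; last by rewrite (negbTE (ord0_notin_graft _ _ _)).
  by case: (unliftP ord0 v) => [x|] -> //; rewrite mem_graft_lift => /iF.
Qed.

Lemma graft_roots F s :
  forest_roots (graft F s) =
  ord0 |: lift ord0 @: (forest_roots F :\: [set w in s]).
Proof.
apply/setP => w; rewrite !inE.
case: (unliftP ord0 w) => [u|] ->; last first.
  by rewrite eqxx; apply/forallP => v; apply: ord0_notin_graft.
rewrite [lift _ _ == _]eq_sym (negbTE (neq_lift _ _)) /=.
rewrite mem_imset ?inE; last exact: lift_inj.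
apply/forallP/andP => [rG|[us /forallP rF] v].
  split; first by rewrite -(mem_graft0 F).
  by apply/forallP => v; rewrite -(mem_graft_lift F s).
by case: (unliftP ord0 v) => [x|] ->; rewrite ?mem_graft_lift ?mem_graft0.
Qed.

Lemma graft_num_trees F s : uniq s -> all [in forest_roots F] s ->
  (num_trees (graft F s) + size s = (num_trees F).+1)%N.
Proof.
move=> us rs; rewrite /num_trees graft_roots cardsU1.
have -> /= : ord0 \notin lift ord0 @: (forest_roots F :\: [set w in s]).
  by apply/imsetP => -[w _ /eqP]; rewrite (negbTE (neq_lift _ _)).
rewrite card_imset; last exact: lift_inj.
have card_s : #|[set w in s]| = size s by rewrite cardsE; apply/card_uniqP.
have sub_s : [set w in s] \subset forest_roots F.
  by apply/subsetP => w; rewrite inE => /(allP rs).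
by rewrite cardsD (setIidPr sub_s) card_s add1n addSn subnK // -card_s subset_leq_card.
Qed.

(** No parent is smaller than [ord0], so [levelE] counts the other roots, and its extra 1 stands for
    the root [ord0] itself. *)
Lemma level_ord0 G : is_increasing_ordered_forest G -> level G ord0 = num_trees G.
Proof.
move=> hG; have [_ _ iG] := increasing_ordered_forestP _ hG.
rewrite levelE //; have r0 : ord0 \in forest_roots G.
  by rewrite inE; apply/forallP => v; apply/negP => /iG.
rewrite /num_trees [RHS](cardsD1 ord0) r0 add1n; congr _.+1; apply: eq_card => w.
by rewrite !inE lt0n; congr (_ && _).
Qed.

(** The new vertex lies below every old one, so for [levelE] being its child has the same effect as
    being a root. *)
Lemma level_graft F s v : is_increasing_ordered_forest (graft F s) ->
  level (graft F s) (lift ord0 v) = level F v.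
Proof.
move=> hG; have /and3P[hF _ _] : [&& is_increasing_ordered_forest F, uniq s
  & all [in forest_roots F] s] by rewrite -graft_forest.
rewrite !levelE //; congr _.+1; rewrite -[RHS](card_imset _ (@lift_inj _ ord0)).
apply: eq_card => w; rewrite !inE.
case: (unliftP ord0 w) => [u|] ->; last first.
  by apply/esym/imsetP => -[u _ /eqP]; rewrite (negbTE (neq_lift _ _)).
rewrite mem_imset ?inE; last exact: lift_inj.
congr (_ && _); apply/forallP/forallP => [ltG x|ltF x].
  by have := ltG (lift ord0 x); rewrite mem_graft_lift.
by case: (unliftP ord0 x) => [y|] ->; rewrite ?mem_graft_lift ?implybT //; apply: ltF.
Qed.

End AddVertex.

(** * Recurrence for the Lah polynomials *)

Section LahRecurrence.
Variables (R : comNzRingType) (phi : nat -> nat -> R).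

Lemma Lah0 k : Lah phi 0 k = (k == 0%N)%:R.
Proof.
have num0 (F : children_map 0) : num_trees F = 0%N.
  by apply/eqP; rewrite -leqn0 num_trees_le.
case: k => [|k]; last by rewrite /Lah big1 // => F /andP[_]; rewrite num0.
pose F0 : children_map 0 := [ffun _ => [bseq]].
rewrite /Lah (big_pred1 F0) => [|F]; first by rewrite big_ord0.
rewrite num0 eqxx andbT (_ : F = F0); last by apply/ffunP => -[].
by rewrite /= eqxx; apply/increasing_ordered_forestP; split=> -[].
Qed.

Lemma LahS0 n : Lah phi n.+1 0 = 0.
Proof.
rewrite /Lah big1 // => G /andP[hG].
(* The number of trees equals the level of [ord0], which is a successor. *)
by rewrite -(level_ord0 hG) levelE.
Qed.

Lemma LahSS n k :
  Lah phi n.+1 k.+1 =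
  lmul (Lah phi) (fun j l => Phi_matrix phi j l *+ (j ^_ (j - l))) n k.
Proof.
pose W (F : children_map n) := \prod_(v < n) phi (size (F v)) (level F v).
pose B j : R := Phi_matrix phi j k *+ (j ^_ (j - k)).
rewrite /lmul -/(B _).
(* Both sides become a sum over forests [F] on [n] vertices; on the right, [F] is classified by its
   number of trees, which is at most [n]. *)
transitivity (\sum_(F : children_map n | is_increasing_ordered_forest F)
                W F * B (num_trees F)); last first.
  rewrite (partition_big (fun F => inord (num_trees F) : 'I_n.+1) predT) //=.
  apply: eq_bigr => j _; rewrite /Lah big_distrl /=.
  have inj_num (F : children_map n) :
      (inord (num_trees F) == j) = (num_trees F == j :> nat).
    by rewrite -val_eqE /= inordK // ltnS num_trees_le.
  apply: eq_big => [F|F /andP[_]]; first by rewrite inj_num.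
  by rewrite inj_num => /eqP <-.
pose g (p : children_map n * n.-bseq 'I_n) := graft p.1 p.2.
rewrite /Lah (reindex_onto g (@ungraft n)) /=; last first.
  by move=> G /andP[hG _]; apply: ungraftK.
pose Q F (s : n.-bseq 'I_n) :=
  [&& uniq s, all [in forest_roots F] s & num_trees F == (k + size s)%N].
(* The new vertex has [size p.2] children and level [k.+1], the number of trees after grafting. *)
transitivity (\sum_(p | is_increasing_ordered_forest p.1 && Q p.1 p.2)
    W p.1 * phi (size p.2) k.+1).
  apply: eq_big => [[F s]|[F s]]; rewrite /g /=.
    rewrite graftK eqxx andbT graft_forest /Q -!andbA.
    case: (boolP (uniq s)) => us //=; case: (boolP (all _ s)) => rs //=.
    congr (_ && _); rewrite -(eqn_add2r (size s)) graft_num_trees //.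
  move=> /andP[/andP[hG /eqP num_G] _].
  rewrite big_ord_recl mulrC level_ord0 // num_G graft0 size_map; congr (_ * _).
  by apply: eq_bigr => v _; rewrite level_graft // graft_lift size_map.
rewrite -(pair_big_dep _ Q (fun F s => W F * phi (size s) k.+1)) /=.
apply: eq_bigr => F _; rewrite -big_distrr /=; congr (_ * _).
(* For fixed [F], all admissible [s] have length [j - k] and contribute equally, so only their
   number matters; there are none when [j < k]. *)
set j := num_trees F; rewrite /B /Phi_matrix.
case: leqP => [le_kj|lt_jk]; last first.
  rewrite mul0rn big1 // => s /and3P[_ _ /eqP num_F].
  by move: lt_jk; rewrite /j num_F ltnNge leq_addr.
have le_n : (j - k <= n)%N by apply: leq_trans (leq_subr _ _) (num_trees_le F).
rewrite -(card_uniq_bseqs (forest_roots F) le_n) -sumr_const.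
rewrite [RHS](eq_bigl (Q F)) => [|s].
  by apply: eq_bigr => s /and3P[_ _ /eqP num_F]; rewrite /j num_F addKn.
by rewrite inE /Q; do 2!congr (_ && _); rewrite -/j; lia.
Qed.

End LahRecurrence.

Theorem theorem3p10 (R : comNzRingType) (P : R -> Prop) (hP : nonneg_cone P)
    (r : option nat) (hr : r <> Some 0%N)
    (phi : nat -> nat -> R) (hPhi : TP P r (Phi_matrix phi)) :
  TP P r (fun n k => Lah phi n k) /\
  Hankel_TP P r (fun n => Lah phi n.+1 1).
Proof.
have Phi_low : lower_triangular (Phi_matrix phi).
  by move=> i j lt_ij; rewrite /Phi_matrix leqNgt lt_ij.
have B_TP := TP_ffact hP Phi_low hPhi.
have B_low : lower_triangular (fun j k => Phi_matrix phi j k *+ (j ^_ (j - k))).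
  by move=> i j /Phi_low ->; apply: mul0rn.
split.
  exact: (TP_production hP B_TP B_low (Lah0 phi) (LahS0 phi) (@LahSS _ phi)).
exact: (Hankel_TP_production hP B_TP B_low (Lah0 phi) (LahS0 phi) (@LahSS _ phi)).
Qed.
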